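(* Call patterns $\alpha,\beta\in S_3$ $D$-Wilf equivalent if $d_n(\alpha)=d_n(\beta)$ for all $n\ge3$. Then there are exactly three $D$-Wilf equivalence classes of patterns in $S_3$.
   Context: A permutation $\pi=\pi_1\cdots\pi_n$ contains $\alpha\in S_3$ if there are indices $i<j<k$ with $\pi_i\pi_j\pi_k$ order-isomorphic to $\alpha$, and avoids it otherwise. $d_n(\alpha)$ is the number of $\alpha$-avoiding permutations of $\{1,\dots,n\}$ with no fixed points (no $i$ with $\pi_i=i$). *)

(* Defs.v *)
From mathcomp Require Import all_boot all_fingroup.
From mathcomp Require Import boolp.

Set Implicit Arguments.
Unset Strict Implicit.
Unset Printing Implicit Defensive.

(* 'S_n acts on {0, ..., n-1}: positions and values of a permutation of        *)
(* {1, ..., n} are both shifted by one, so fixed points and relative orders    *)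
(* are unchanged.                                                              *)

Definition order_isomorphic (s t : seq nat) : bool :=
  (size s == size t) &&
  [forall a : 'I_(size s), forall b : 'I_(size s),
     (nth 0 s a < nth 0 s b) == (nth 0 t a < nth 0 t b)].

Definition one_line (n : nat) (pi : 'S_n) : seq nat :=
  [seq nat_of_ord (pi i) | i <- enum 'I_n].

Definition contains (n : nat) (pi : 'S_n) (alpha : 'S_3) : bool :=
  [exists i : 'I_n, exists j : 'I_n, exists k : 'I_n,
     (i < j < k) &&
     order_isomorphic [:: nat_of_ord (pi i); nat_of_ord (pi j); nat_of_ord (pi k)]
                      (one_line alpha)].

Definition avoids (n : nat) (pi : 'S_n) (alpha : 'S_3) : bool :=
  ~~ contains pi alpha.

Definition derangement (n : nat) (pi : 'S_n) : bool :=
  [forall i : 'I_n, pi i != i].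

Definition d (n : nat) (alpha : 'S_3) : nat :=
  #|[set pi : 'S_n | avoids pi alpha && derangement pi]|.

Definition D_Wilf (alpha beta : 'S_3) : Prop :=
  forall n : nat, 3 <= n -> d n alpha = d n beta.

(* Hence equivalence_partition below gives the genuine quotient of 'S_3. *)
Lemma D_Wilf_equivalence :
  {in [set: 'S_3] & &, equivalence_rel (fun alpha beta => `[< D_Wilf alpha beta >])}.
Proof.
move=> x y z _ _ _; split; first by apply/asboolP.
move=> /asboolP xy; apply/asboolP/asboolP => h n n3.
  by rewrite -xy // h.
by rewrite xy // h.
Qed.

(* asbool makes D_Wilf, which quantifies over all n, a boolean relation. *)
Definition D_Wilf_classes : {set {set 'S_3}} :=
  equivalence_partition (fun alpha beta => `[< D_Wilf alpha beta >]) [set: 'S_3].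

(* Main.v *)
(* Inverse and reverse-complement preserve fixed points and identify 231 with
   312 and 132 with 213; n = 3 and n = 4 separate the patterns 123, 132, 231.
   It remains to show that 132 and 321 have equally many derangement avoiders.

   Let C_n count the avoiders of 132 and D_n those without fixed points. In a
   132-avoider with smallest fixed point q, the earlier entries below q occupy
   the positions immediately before q and the values immediately below q, and
   form a derangement A. Deleting them together with q leaves a 132-avoider s,
   and the place where the block A + q has to be put back into s is determined
   by s: it is where the diagonal crosses the staircase of left-to-right minima.
   Hence C_n = D_n + sum_k D_k C_(n-1-k). In a 321-avoider a fixed point splits
   the permutation as a direct sum, which gives the same recurrence (the block is
   always put back at 0). As the recurrence determines D from C, it suffices that
   132 and 321 have equally many avoiders. Up to reversal 321 is 123, and among
   the permutations with given left-to-right minima exactly one avoids 123 and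
   exactly one avoids 132. *)

Require Import Defs.
From mathcomp Require Import all_boot all_fingroup.
From mathcomp Require Import zify.

Set Implicit Arguments.
Unset Strict Implicit.
Unset Printing Implicit Defensive.

(** * Patterns as predicates on triples, permutations as one-line words *)

Definition pattern3 := nat -> nat -> nat -> bool.

Definition p123 : pattern3 := fun x y z => x < y < z.
Definition p132 : pattern3 := fun x y z => x < z < y.
Definition p213 : pattern3 := fun x y z => y < x < z.
Definition p231 : pattern3 := fun x y z => z < x < y.
Definition p312 : pattern3 := fun x y z => y < z < x.
Definition p321 : pattern3 := fun x y z => z < y < x.

Definition occurs (r : pattern3) n (pi : 'S_n) : bool :=
  [exists i : 'I_n, exists j : 'I_n, exists k : 'I_n,
     (i < j < k) && r (pi i) (pi j) (pi k)].

Lemma occursP (r : pattern3) n (pi : 'S_n) :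
  reflect (exists i j k : 'I_n, [/\ i < j, j < k & r (pi i) (pi j) (pi k)])
          (occurs r pi).
Proof.
apply: (iffP existsP) => [[i /existsP[j /existsP[k /andP[/andP[ij jk] h]]]]|].
  by exists i, j, k.
move=> [i [j [k [ij jk h]]]]; exists i; apply/existsP; exists j.
by apply/existsP; exists k; rewrite ij jk.
Qed.

Lemma eq_occurs (r r' : pattern3) n (pi : 'S_n) :
  (forall x y z, r x y z = r' x y z) -> occurs r pi = occurs r' pi.
Proof.
by move=> e; apply/occursP/occursP => -[i [j [k [ij jk h]]]]; exists i, j, k;
  rewrite ?e // -e.
Qed.

Lemma order_isomorphic3 x y z p q r :
  order_isomorphic [:: x; y; z] [:: p; q; r] =
  [&& (x < y) == (p < q), (x < z) == (p < r), (y < x) == (q < p),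
      (y < z) == (q < r), (z < x) == (r < p) & (z < y) == (r < q)].
Proof.
rewrite /order_isomorphic /=; apply/forallP/and5P.
  move=> h; have h2 a b : a < 3 -> b < 3 ->
      (nth 0 [:: x; y; z] a < nth 0 [:: x; y; z] b) ==
      (nth 0 [:: p; q; r] a < nth 0 [:: p; q; r] b).
    by move=> ha hb; have /forallP /(_ (Ordinal hb)) := h (Ordinal ha).
  have:= (h2 0 1 isT isT, h2 0 2 isT isT, h2 1 0 isT isT, h2 1 2 isT isT,
          h2 2 0 isT isT, h2 2 1 isT isT).
  by rewrite /= => -[[[[[-> ->] ->] ->] ->] ->].
move=> [h1 h2 h3 h4 /andP[h5 h6]] [a ha]; apply/forallP => -[b hb] /=.
move: a b ha hb => [|[|[|a]]] [|[|[|b]]] //= _ _; by rewrite ?ltnn.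
Qed.

(** Avoidance for words: it makes sense for the pieces cut out of a permutation, and it evaluates by
    computation, unlike quantifiers over ordinals. *)
Fixpoint avl (r : pattern3) (s : seq nat) : bool :=
  if s is x :: t then pairwise (fun y z => ~~ r x y z) t && avl r t else true.

Lemma avlP (r : pattern3) s :
  reflect (forall i j k, i < j -> j < k -> k < size s ->
             ~~ r (nth 0 s i) (nth 0 s j) (nth 0 s k))
          (avl r s).
Proof.
elim: s => [|x s IH] /=; first by apply: ReflectT => i j k.
apply: (iffP andP) => [[/(pairwiseP 0) h1 /IH h2]|h].
  case=> [|i] [|j] [|k] //= ij jk ks; last exact: h2.
  by apply: h1 => //; rewrite inE /= in ks *; lia.
split; last by apply/IH => i j k ij jk ks; exact: (h i.+1 j.+1 k.+1).
by apply/(pairwiseP 0) => j k; rewrite !inE => js ks jk; exact: (h 0 j.+1 k.+1).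
Qed.

Lemma size_one_line n (pi : 'S_n) : size (one_line pi) = n.
Proof. by rewrite size_map size_enum_ord. Qed.

Lemma nth_one_line n (pi : 'S_n) (i : 'I_n) : nth 0 (one_line pi) i = pi i.
Proof. by rewrite (nth_map i) ?size_enum_ord // nth_ord_enum. Qed.

Lemma avl_one_line (r : pattern3) n (pi : 'S_n) :
  avl r (one_line pi) = ~~ occurs r pi.
Proof.
apply/avlP/idP => [h|/negP h i j k ij jk].
  apply/negP => /occursP[i [j [k [ij jk]]]].
  by rewrite -!nth_one_line; apply/negP/h; rewrite ?size_one_line.
rewrite size_one_line => kn; have jn := ltn_trans jk kn; have i_n := ltn_trans ij jn.
apply/negP => hr; apply: h; apply/occursP.
exists (Ordinal i_n), (Ordinal jn), (Ordinal kn).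
by rewrite -!nth_one_line.
Qed.

Definition deranged (s : seq nat) : bool :=
  all (fun i => nth 0 s i != i) (iota 0 (size s)).

Lemma derangedP s :
  reflect (forall i, i < size s -> nth 0 s i <> i) (deranged s).
Proof.
apply: (iffP allP) => [h i si|h i]; first by apply/eqP/h; rewrite mem_iota.
by rewrite mem_iota => si; apply/eqP/h.
Qed.

Lemma deranged_one_line n (pi : 'S_n) : deranged (one_line pi) = derangement pi.
Proof.
apply/derangedP/forallP => [h i|h i].
  by have := h i; rewrite size_one_line nth_one_line => /(_ (ltn_ord i)) /eqP.
rewrite size_one_line => i_n fix_i; have /eqP := h (Ordinal i_n); apply.
by apply: val_inj; rewrite /= -nth_one_line.
Qed.

Lemma one_line_inj n : injective (@one_line n).
Proof.
move=> pi rho e; apply/permP => i; apply: val_inj.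
by rewrite /= -!nth_one_line e.
Qed.

Lemma perm_one_line n (pi : 'S_n) : perm_eq (one_line pi) (iota 0 n).
Proof.
apply: uniq_perm; rewrite ?iota_uniq //.
  by rewrite map_inj_uniq ?enum_uniq // => i j /val_inj /perm_inj.
move=> x; rewrite mem_iota /=; apply/mapP/idP => [[i _ ->]|xn].
  by rewrite ltn_ord.
exists ((pi^-1)%g (Ordinal xn)); first by rewrite mem_enum.
by rewrite permKV.
Qed.

Lemma one_line_surj n s : perm_eq s (iota 0 n) -> exists pi : 'S_n, one_line pi = s.
Proof.
move=> sp; have ss : size s = n by rewrite (perm_size sp) size_iota.
have us : uniq s by rewrite (perm_uniq sp) iota_uniq.
have h (i : 'I_n) : nth 0 s i < n.
  have : nth 0 s i \in s by rewrite mem_nth ?ss.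
  by rewrite (perm_mem sp) mem_iota.
have inj : injective (fun i => Ordinal (h i)).
  move=> i j [] /eqP; rewrite nth_uniq ?ss // => /eqP; exact: val_inj.
exists (perm inj); apply: (@eq_from_nth _ 0); first by rewrite size_one_line.
move=> i; rewrite size_one_line => i_n.
by rewrite (nth_one_line _ (Ordinal i_n)) permE.
Qed.

(** Bridge from sets of permutations to lists of words: [one_line] is injective and hits every
    rearrangement of 0, ..., n-1. *)
Lemma card_one_line n (P : pred (seq nat)) :
  #|[set pi : 'S_n | P (one_line pi)]| = count P (permutations (iota 0 n)).
Proof.
rewrite cardsE cardE -size_filter -(size_map (@one_line n)).
apply/perm_size/uniq_perm.
- by rewrite map_inj_uniq ?enum_uniq //; exact: one_line_inj.
- by rewrite filter_uniq // permutations_uniq.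
move=> s; rewrite mem_filter mem_permutations; apply/mapP/andP.
  by move=> [pi]; rewrite mem_enum => h ->; rewrite perm_one_line.
move=> [Ps /one_line_surj[pi e]]; exists pi => //.
by rewrite mem_enum unfold_in /= e.
Qed.

(** * Symmetries: inverse, reverse-complement, reversal *)

Lemma derangementP n (pi : 'S_n) :
  reflect (forall i, pi i <> i) (derangement pi).
Proof. by apply: (iffP forallP) => h i; apply/eqP; exact: h. Qed.

Lemma card_involution (T : finType) (f : T -> T) (P Q : pred T) :
  involutive f -> (forall x, P x -> Q (f x)) -> (forall x, Q x -> P (f x)) ->
  #|[set x | P x]| = #|[set x | Q x]|.
Proof.
move=> fK PQ QP; rewrite -(card_imset [set x | Q x] (inv_inj fK)).
apply: eq_card => x; rewrite inE; apply/idP/imsetP => [Px|[y + ->]].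
  by exists (f x); rewrite ?fK // inE PQ.
by rewrite inE; exact: QP.
Qed.

Definition card_derangements (r : pattern3) n : nat :=
  #|[set pi : 'S_n | ~~ occurs r pi && derangement pi]|.

Definition card_avoiders (r : pattern3) n : nat :=
  #|[set pi : 'S_n | ~~ occurs r pi]|.

(** Inversion exchanges positions and values: the values x, y, z become positions carrying i, j, k.
    The six disjuncts are the possible orders of these new positions. *)
Lemma occursV (r r' : pattern3) n (pi : 'S_n) :
    (forall i j k x y z, i < j < k -> r x y z ->
       (r' i j k && (x < y < z)) || (r' i k j && (x < z < y)) ||
       (r' j i k && (y < x < z)) || (r' j k i && (y < z < x)) ||
       (r' k i j && (z < x < y)) || (r' k j i && (z < y < x))) ->
  occurs r pi -> occurs r' (pi^-1)%g.
Proof.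
move=> rr' /occursP[i [j [k [ij jk h]]]]; apply/occursP.
have /rr' /(_ h) : i < j < k by rewrite ij.
by case/orP => [/orP[/orP[/orP[/orP[]|]|]|]|] /andP[h1 /andP[h2 h3]];
  do 3 eexists; (split; [exact: h2 | exact: h3 | by rewrite !permK]).
Qed.

Lemma derangementV n (pi : 'S_n) : derangement pi -> derangement (pi^-1)%g.
Proof.
by move=> /derangementP h; apply/derangementP => i e; apply: (h i);
  rewrite -[in LHS]e permKV.
Qed.

Lemma card_derangements_231_312 n :
  card_derangements p231 n = card_derangements p312 n.
Proof.
apply: (card_involution (f := fun pi : 'S_n => (pi^-1)%g)).
- exact: invgK.
- move=> pi /andP[h /derangementV ->]; rewrite andbT; apply: contra h.
  rewrite -{2}(invgK pi); apply: occursV => i j k x y z.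
  by rewrite /p231 /p312; lia.
- move=> pi /andP[h /derangementV ->]; rewrite andbT; apply: contra h.
  rewrite -{2}(invgK pi); apply: occursV => i j k x y z.
  by rewrite /p231 /p312; lia.
Qed.

Definition rev_perm n : 'S_n := perm (@rev_ord_inj n).

Lemma rev_permE n (i : 'I_n) : rev_perm n i = rev_ord i.
Proof. exact: permE. Qed.

Lemma rev_perm2 n : (rev_perm n * rev_perm n = 1)%g.
Proof. by apply/permP => i; rewrite permM !rev_permE perm1 rev_ordK. Qed.

(** Conjugation by the reversal, which therefore carries fixed points to fixed points. *)
Definition reverse_complement n (pi : 'S_n) : 'S_n :=
  (rev_perm n * pi * rev_perm n)%g.

Lemma reverse_complementE n (pi : 'S_n) i :
  reverse_complement pi i = rev_ord (pi (rev_ord i)).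
Proof. by rewrite !permM !rev_permE. Qed.

Lemma reverse_complementK n : involutive (@reverse_complement n).
Proof. by move=> pi; apply/permP => i; rewrite !reverse_complementE !rev_ordK. Qed.

Lemma occurs_reverse_complement (r r' : pattern3) n (pi : 'S_n) :
    (forall m x y z, x < m -> y < m -> z < m ->
       r x y z -> r' (m - z.+1) (m - y.+1) (m - x.+1)) ->
  occurs r pi -> occurs r' (reverse_complement pi).
Proof.
move=> rr' /occursP[i [j [k [ij jk h]]]]; apply/occursP.
exists (rev_ord k), (rev_ord j), (rev_ord i).
rewrite !reverse_complementE !rev_ordK /=.
have [[_ j_n] k_n] := (ltn_ord i, ltn_ord j, ltn_ord k).
by split; [lia | lia | apply: rr'].
Qed.

Lemma derangement_reverse_complement n (pi : 'S_n) :
  derangement pi -> derangement (reverse_complement pi).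
Proof.
move=> /derangementP h; apply/derangementP => i; rewrite reverse_complementE => e.
by apply: (h (rev_ord i)); apply: rev_ord_inj; rewrite rev_ordK.
Qed.

Lemma card_derangements_132_213 n :
  card_derangements p132 n = card_derangements p213 n.
Proof.
apply: (card_involution (@reverse_complementK n)).
- move=> pi /andP[h /derangement_reverse_complement ->]; rewrite andbT.
  apply: contra h; rewrite -{2}(reverse_complementK pi).
  apply: occurs_reverse_complement => m x y z; rewrite /p132 /p213; lia.
- move=> pi /andP[h /derangement_reverse_complement ->]; rewrite andbT.
  apply: contra h; rewrite -{2}(reverse_complementK pi).
  apply: occurs_reverse_complement => m x y z; rewrite /p132 /p213; lia.
Qed.

(** Reversal alone may create or destroy fixed points, so it serves only to compare the numbers of
    all avoiders. *)
Lemma occurs_reverse (r r' : pattern3) n (pi : 'S_n) :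
    (forall x y z, r x y z -> r' z y x) ->
  occurs r pi -> occurs r' (rev_perm n * pi)%g.
Proof.
move=> rr' /occursP[i [j [k [ij jk h]]]]; apply/occursP.
exists (rev_ord k), (rev_ord j), (rev_ord i).
rewrite !permM !rev_permE !rev_ordK /=.
have [[_ j_n] k_n] := (ltn_ord i, ltn_ord j, ltn_ord k).
by split; [lia | lia | apply: rr'].
Qed.

Lemma card_avoiders_123_321 n : card_avoiders p123 n = card_avoiders p321 n.
Proof.
have rK : involutive (fun pi : 'S_n => rev_perm n * pi)%g.
  by move=> pi; rewrite mulgA rev_perm2 mul1g.
apply: (card_involution rK) => pi; apply: contra; rewrite -{2}(rK pi);
  apply: occurs_reverse => x y z; rewrite /p123 /p321; lia.
Qed.

(** * Avoiders of 123 and of 132 *)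

(* The region weakly above some point of the graph in an earlier or equal
   position; it carries the same information as the left-to-right minima. *)
Definition minima_region n (pi : 'S_n) : {set 'I_n * 'I_n} :=
  [set p : 'I_n * 'I_n | [exists j : 'I_n, (j <= p.1) && (pi j <= p.2)]].

Lemma mem_minima_region n (pi : 'S_n) (i v : 'I_n) :
  reflect (exists2 j : 'I_n, j <= i & pi j <= v) ((i, v) \in minima_region pi).
Proof.
rewrite inE; apply: (iffP existsP) => [[j /andP[]]|[j h1 h2]]; exists j => //.
by rewrite /= h1.
Qed.

Definition swap n (pi : 'S_n) (b c : 'I_n) : 'S_n := (tperm b c * pi)%g.

Lemma swapE n (pi : 'S_n) (b c i : 'I_n) : swap pi b c i = pi (tperm b c i).
Proof. exact: permM. Qed.

Lemma swapK n (pi : 'S_n) (b c : 'I_n) : swap (swap pi b c) b c = pi.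
Proof. by apply/permP => i; rewrite !swapE tpermK. Qed.

(** Positions b and c both carry entries above the earlier entry at a, so wherever b or c witnesses
    membership in the region, a does too. One inclusion suffices, since the swap is an involution
    that preserves the hypotheses. *)
Lemma minima_region_swap n (pi : 'S_n) (a b c : 'I_n) :
    a < b -> b < c -> pi a < pi b -> pi a < pi c ->
  minima_region (swap pi b c) = minima_region pi.
Proof.
have sub (rho : 'S_n) : a < b -> b < c -> rho a < rho b -> rho a < rho c ->
    minima_region rho \subset minima_region (swap rho b c).
  move=> ab bc hb hc; apply/subsetP => -[i v] /mem_minima_region[j ji jv].
  apply/mem_minima_region.
  have ae : swap rho b c a = rho a by rewrite swapE tpermD // -val_eqE /=; lia.
  have [jb|jb] := eqVneq j b; first by subst j; exists a; rewrite ?ae; lia.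
  have [jc|jc] := eqVneq j c; first by subst j; exists a; rewrite ?ae; lia.
  by exists j => //; rewrite swapE tpermD // eq_sym.
move=> ab bc hb hc; apply/eqP; rewrite eqEsubset sub // andbT -{2}(swapK pi b c).
have ae : swap pi b c a = pi a by rewrite swapE tpermD // -val_eqE /=; lia.
by apply: sub => //; rewrite ae swapE ?tpermL ?tpermR.
Qed.

Definition moment n (pi : 'S_n) : nat := \sum_(i < n) i * pi i.

(** Rearrangement: only the terms at b and c change, and the sum drops by (c - b)(pi c - pi b). *)
Lemma moment_swap n (pi : 'S_n) (b c : 'I_n) :
  b < c -> pi b < pi c -> moment (swap pi b c) < moment pi.
Proof.
move=> bc hbc; have cb : c != b by rewrite -val_eqE /=; lia.
rewrite /moment (bigD1 b) // (bigD1 c) //= [X in _ < X](bigD1 b) // (bigD1 c) //=.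
rewrite !swapE tpermL tpermR !addnA.
rewrite (eq_bigr (fun i : 'I_n => i * pi i)); last first.
  by move=> i /andP[ib ic]; rewrite swapE tpermD // eq_sym.
rewrite ltn_add2r; nia.
Qed.

(* A minimiser of the moment in the fibre avoids 123: in an occurrence, exchanging
   the last two entries keeps the minima and lowers the moment. *)
Lemma exists_123_avoider n (pi : 'S_n) :
  exists2 rho, ~~ occurs p123 rho & minima_region rho = minima_region pi.
Proof.
have [rho /eqP e m] := arg_minnP (P := fun rho => minima_region rho == minima_region pi)
  (@moment n) (eqxx (minima_region pi)).
exists rho => //; apply/negP => /occursP[a [b [c [ab bc /andP[h1 h2]]]]].
have := m (swap rho b c).
rewrite (minima_region_swap (a := a)) ?e ?eqxx //; last by lia.
by move=> /(_ isT); rewrite leqNgt moment_swap.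
Qed.

(** Dually, a maximiser of the moment works: in an occurrence of 132 the last two entries descend,
    and exchanging them keeps the minima and raises the moment. *)
Lemma exists_132_avoider n (pi : 'S_n) :
  exists2 rho, ~~ occurs p132 rho & minima_region rho = minima_region pi.
Proof.
have bound (rho : 'S_n) : moment rho <= n * (n * n).
  have -> : n * (n * n) = \sum_(i < n) n * n by rewrite sum_nat_const card_ord.
  apply: leq_sum => i _.
  by have := ltn_ord i; have := ltn_ord (rho i); nia.
have [rho /eqP e m] := arg_maxnP
  (P := fun rho => minima_region rho == minima_region pi) (@moment n) 
  (eqxx (minima_region pi)).
exists rho => //; apply/negP => /occursP[a [b [c [ab bc /andP[h1 h2]]]]].
have := m (swap rho b c).
rewrite (minima_region_swap (a := a)) ?e ?eqxx //; last by lia.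
move=> /(_ isT) /=; rewrite leqNgt -{1}(swapK rho b c) moment_swap //.
by rewrite !swapE tpermL tpermR.
Qed.

Lemma first_difference n (pi rho : 'S_n) :
  pi <> rho -> exists2 i : 'I_n, pi i <> rho i & forall j : 'I_n, j < i -> pi j = rho j.
Proof.
move=> ne; have [i0 h0] : exists i, pi i != rho i.
  apply/existsP; apply: contra_notT ne; rewrite negb_exists => /forallP h.
  by apply/permP => i; apply/eqP; rewrite -[_ == _]negbK.
have [i /eqP ni m] := arg_minnP (P := fun i => pi i != rho i) (fun i : 'I_n => i : nat) h0.
exists i => // j ji; apply/eqP; rewrite -[_ == _]negbK; apply/negP => /m.
by rewrite leqNgt ji.
Qed.

(** Equal regions force an entry before i that is smaller than pi i. With it, pi i followed by the
    later value rho i is a 123 in pi, and rho i followed by the later value pi i is a 132 in rho. *)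
Lemma first_difference_patterns n (pi rho : 'S_n) (i : 'I_n) :
    minima_region pi = minima_region rho ->
    (forall j : 'I_n, j < i -> pi j = rho j) -> pi i < rho i ->
  occurs p123 pi /\ occurs p132 rho.
Proof.
move=> e agree lt_i.
have /mem_minima_region[j ji jv] : (i, pi i) \in minima_region rho.
  by rewrite -e; apply/mem_minima_region; exists i.
have {}ji : j < i.
  rewrite ltn_neqAle ji andbT; apply/eqP => /val_inj ji'.
  by rewrite ji' in jv; lia.
have ej := agree _ ji.
have {}jv : pi j < pi i.
  rewrite ej ltn_neqAle jv andbT -ej; apply/eqP => /val_inj /perm_inj ji'.
  by rewrite ji' ltnn in ji.
(* A value that tau has at i but sigma does not must come after i in sigma, because the entries
   before i are the same in both. *)
have later (sigma tau : 'S_n) v : (forall j : 'I_n, j < i -> sigma j = tau j) ->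
    tau i = v -> sigma i <> v -> i < (sigma^-1)%g v.
  move=> ag tv sv; rewrite ltnNge leq_eqVlt; apply/negP => /orP[/eqP/val_inj k|k].
    by apply: sv; rewrite -k permKV.
  have := ag _ k; rewrite permKV -tv => /perm_inj k'.
  by move: k; rewrite -tv -k' ltnn.
split; apply/occursP.
- exists j, i, ((pi^-1)%g (rho i)); rewrite permKV /p123 jv lt_i; split=> //.
  by apply: (later _ rho) => // h; rewrite h ltnn in lt_i.
- exists j, i, ((rho^-1)%g (pi i)); rewrite permKV /p132 -ej jv lt_i; split=> //.
  apply: (later _ pi) => [k ki||h] //; first by rewrite agree.
  by rewrite h ltnn in lt_i.
Qed.

Lemma minima_region_inj (r : pattern3) n :
    r = p123 \/ r = p132 ->
  {in [set pi : 'S_n | ~~ occurs r pi] &, injective (@minima_region n)}.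
Proof.
move=> hr pi rho; rewrite !inE => av1 av2 e.
have [//|/eqP/first_difference[i ni agree]] := eqVneq pi rho.
have agree' (j : 'I_n) : j < i -> rho j = pi j by move=> /agree.
have [lt_i|lt_i|/val_inj//] := ltngtP (pi i) (rho i).
- have [o1 o2] := first_difference_patterns e agree lt_i.
  by case: hr av1 av2 => ->; rewrite ?o1 ?o2.
- have [o1 o2] := first_difference_patterns (esym e) agree' lt_i.
  by case: hr av1 av2 => ->; rewrite ?o1 ?o2.
Qed.

(** On either class of avoiders the region is an injective invariant, and both images consist of all
    regions of permutations. *)
Lemma card_avoiders_123_132 n : card_avoiders p123 n = card_avoiders p132 n.
Proof.
rewrite /card_avoiders -(card_in_imset (minima_region_inj (or_introl erefl))).
rewrite -(card_in_imset (minima_region_inj (or_intror erefl))).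
congr #|pred_of_set _|; apply/setP => K; apply/imsetP/imsetP => -[pi _ ->].
- by have [rho ? e] := exists_132_avoider pi; exists rho; rewrite ?inE.
- by have [rho ? e] := exists_123_avoider pi; exists rho; rewrite ?inE.
Qed.

(** * The recurrence on the first fixed point *)

Definition is_perm (s : seq nat) : bool := perm_eq s (iota 0 (size s)).

(** Bounded and injective suffices by pigeonhole; stated on indices p < q so that later goals fall
    to linear arithmetic. *)
Lemma is_permP s :
  reflect ((forall p, p < size s -> nth 0 s p < size s) /\
           (forall p q, p < q -> q < size s -> nth 0 s p <> nth 0 s q))
          (is_perm s).
Proof.
apply: (iffP idP) => [sp|[bound inj]].
  have us : uniq s by rewrite (perm_uniq sp) iota_uniq.
  split=> [p ps|p q pq qs /eqP]; last first.
    by rewrite nth_uniq // ?(ltn_trans pq) // => /eqP e; rewrite e ltnn in pq.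
  by have := mem_nth 0 ps; rewrite (perm_mem sp) mem_iota.
have us : uniq s.
  apply/(uniqP 0) => p q; rewrite !inE => ps qs e.
  by have [/inj|/inj|//] := ltngtP p q => /(_ ltac:(done)) h; case: h.
have sub : {subset s <= iota 0 (size s)}.
  by move=> x /(nthP 0)[p ps <-]; rewrite mem_iota bound.
have [_ e] := uniq_min_size us sub (eq_leq (size_iota _ _)).
exact: uniq_perm us (iota_uniq _ _) e.
Qed.

Lemma perm_surj s v : is_perm s -> v < size s -> exists2 p, p < size s & nth 0 s p = v.
Proof. by move=> sp vs; apply/nthP; rewrite (perm_mem sp) mem_iota. Qed.

(* Opens a gap of width [w] at height [i]. *)
Definition raise (i w v : nat) : nat := if v < i then v else v + w.

(** Closes the gap opened by [raise i w]; meaningful for values outside that gap. *)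
Definition lower (i w v : nat) : nat := if v < i then v else v - w.

(* Inserts into [s], at position and value [i], a block order-isomorphic to
   [A] followed by a maximal entry; that entry lands on the diagonal. *)
Definition inflate (i : nat) (A s : seq nat) : seq nat :=
  mkseq (fun p =>
    if p < i then raise i (size A).+1 (nth 0 s p)
    else if p < i + size A then i + nth 0 A (p - i)
    else if p == i + size A then p
    else raise i (size A).+1 (nth 0 s (p - (size A).+1)))
  (size s + (size A).+1).

Lemma size_inflate i A s : size (inflate i A s) = size s + (size A).+1.
Proof. exact: size_mkseq. Qed.

(* Given a fixed point [q], the two pieces from which [inflate i] rebuilds [s]. *)
Definition block (i q : nat) (s : seq nat) : seq nat :=
  mkseq (fun p => nth 0 s (i + p) - i) (q - i).

Definition rest (i q : nat) (s : seq nat) : seq nat :=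
  mkseq (fun p => lower i (q.+1 - i)
                    (nth 0 s (raise i (q.+1 - i) p)))
        (size s - (q.+1 - i)).

Lemma raiseP i w v : (v < i /\ raise i w v = v) \/ (i <= v /\ raise i w v = v + w).
Proof. by rewrite /raise; case: ltnP; [left | right]. Qed.

Lemma is_perm_rcons A : is_perm A -> is_perm (rcons A (size A)).
Proof.
move=> pA; rewrite /is_perm size_rcons -(addn1 (size A)) iotaD add0n cats1.
by rewrite -!cats1 perm_cat2r.
Qed.

(** Three zones: before the block, where all values are at least i and so get shifted; the block
    together with its maximum, read as [rcons A (size A)]; and after it. Later proofs about
    [inflate] split along these zones. *)
Lemma inflateP i A s p :
    i <= size s -> all (leq i) (take i s) -> p < size (inflate i A s) ->
  [\/ [/\ p < i, i <= nth 0 s p & nth 0 (inflate i A s) p = nth 0 s p + (size A).+1],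
      i <= p <= i + size A /\
      nth 0 (inflate i A s) p = i + nth 0 (rcons A (size A)) (p - i) |
      [/\ i + size A < p, p - (size A).+1 < size s &
          nth 0 (inflate i A s) p = raise i (size A).+1 (nth 0 s (p - (size A).+1))]].
Proof.
move=> im /(all_nthP 0) hi; rewrite size_inflate => pn; rewrite nth_mkseq //.
have := hi p; rewrite size_take_min (minn_idPl im).
have [pi /(_ isT)|ip _] := ltnP p i.
  rewrite nth_take // => ip.
  by constructor 1; split=> //; rewrite /raise ltnNge ip.
have [pA|Ap] := ltnP p (i + size A).
  constructor 2; rewrite ltnW // nth_rcons ifT //; lia.
case: eqP => [->|ne].
  by constructor 2; split; [lia | rewrite addKn nth_rcons ltnn eqxx].
by constructor 3; split; [lia | lia | ].
Qed.

Lemma inflate_perm i A s :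
  i <= size s -> all (leq i) (take i s) -> is_perm A -> is_perm s -> is_perm (inflate i A s).
Proof.
move=> im hi /is_perm_rcons /is_permP[]; rewrite size_rcons => bA injA.
move=> /is_permP[bs injs]; apply/is_permP; split=> [p pn|p q pq qn].
  have [[pi h ->]|[pi ->]|[pi h ->]] := inflateP im hi pn; rewrite size_inflate.
  - by have := bs p; lia.
  - by have := bA (p - i); lia.
  - have := bs _ h; have [[_ ->]|[_ ->]] := raiseP i (size A).+1 (nth 0 s (p - (size A).+1));
      lia.
have := inflateP im hi (ltn_trans pq qn); have := inflateP im hi qn.
have rP v := raiseP i (size A).+1 v.
move=> [[qi hq ->]|[qi ->]|[qi hq ->]] [[pi hp ->]|[pi ->]|[pi hp ->]]; try lia.
- by have := injs p q pq; lia.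
- by have := bA (q - i); lia.
- by have := injA (p - i) (q - i); lia.
- have := injs p _ _ hq; have [[? ->]|[? ->]] := rP (nth 0 s (q - (size A).+1)); lia.
- by have := bA (p - i); have [[? ->]|[? ->]] := rP (nth 0 s (q - (size A).+1)); lia.
- have := injs (p - (size A).+1) _ _ hq.
  have [[? ->]|[? ->]] := rP (nth 0 s (q - (size A).+1));
  have [[? ->]|[? ->]] := rP (nth 0 s (p - (size A).+1)); lia.
Qed.

Lemma lowerK i q v :
  i <= q -> ~~ (i <= v <= q) -> raise i (q - i).+1 (lower i (q.+1 - i) v) = v.
Proof.
move=> iq out; rewrite /lower; case: ltnP => vi; first by rewrite /raise vi.
by rewrite /raise ifF; lia.
Qed.

(** The hypotheses keep every entry outside positions i to q away from the values i to q, so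
    lowering followed by raising restores it. *)
Lemma inflate_block_rest i q s :
    i <= q -> q < size s -> nth 0 s q = q ->
    (forall p, p < i -> q < nth 0 s p) ->
    (forall p, i <= p < q -> i <= nth 0 s p < q) ->
    (forall p, q < p < size s -> ~~ (i <= nth 0 s p <= q)) ->
  inflate i (block i q s) (rest i q s) = s.
Proof.
move=> iq qn sq hN hS hR; apply: (@eq_from_nth _ 0).
  by rewrite size_inflate !size_mkseq; lia.
move=> p; rewrite size_inflate => pn; rewrite nth_mkseq //.
rewrite !size_mkseq in pn *.
have [pi|ip] := ltnP p i.
  rewrite nth_mkseq; last by lia.
  by rewrite {2}/raise pi lowerK //; have := hN p pi; lia.
have [pq|qp] := ltnP p (i + (q - i)).
  rewrite nth_mkseq; last by lia.
  by rewrite (subnKC ip); have := hS p; lia.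
case: eqP => [->|ne]; first by rewrite subnKC // sq.
rewrite nth_mkseq; last by lia.
have -> : raise i (q.+1 - i) (p - (q - i).+1) = p by rewrite /raise ifF; lia.
by rewrite lowerK ?hR //; lia.
Qed.

Lemma block_perm i q s :
    is_perm s -> q < size s -> (forall p, i <= p < q -> i <= nth 0 s p < q) ->
  is_perm (block i q s).
Proof.
move=> /is_permP[bs injs] qn hS; apply/is_permP; rewrite size_mkseq; split.
  by move=> p pn; rewrite nth_mkseq //; have := hS (i + p); lia.
move=> p p' pp' pn; rewrite !nth_mkseq //; last by lia.
by have := injs (i + p) (i + p'); have := hS (i + p); have := hS (i + p'); lia.
Qed.

Lemma raise_lt i w p p' : p < p' -> raise i w p < raise i w p'.
Proof. by rewrite /raise; case: (ltnP p i) => ?; case: (ltnP p' i) => ?; lia. Qed.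

Lemma raise_out i q p : i <= q -> ~~ (i <= raise i (q.+1 - i) p <= q).
Proof. by rewrite /raise => ?; case: (ltnP p i) => ?; lia. Qed.

Lemma lower_lt i q v v' :
    i <= q -> ~~ (i <= v <= q) -> ~~ (i <= v' <= q) ->
  (lower i (q.+1 - i) v < lower i (q.+1 - i) v') = (v < v').
Proof.
by rewrite /lower => iq; case: (ltnP v i) => ?; case: (ltnP v' i) => ?; lia.
Qed.

Lemma raise_range i q n p :
  i <= q < n -> p < n - (q.+1 - i) -> raise i (q.+1 - i) p < n.
Proof. by rewrite /raise => ?; case: (ltnP p i) => ?; lia. Qed.

Lemma rest_values i q s :
    i <= q -> (forall p, p < i -> q < nth 0 s p) ->
    (forall p, q < p < size s -> ~~ (i <= nth 0 s p <= q)) ->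
  forall p, ~~ (i <= p <= q) -> p < size s -> ~~ (i <= nth 0 s p <= q).
Proof. by move=> iq hN hR p; have := hN p; have := hR p; lia. Qed.

Lemma rest_perm i q s :
    is_perm s -> i <= q < size s ->
    (forall p, p < i -> q < nth 0 s p) ->
    (forall p, q < p < size s -> ~~ (i <= nth 0 s p <= q)) ->
  is_perm (rest i q s).
Proof.
move=> /is_permP[bs injs] qn hN hR; have iq : i <= q by lia.
have out := rest_values iq hN hR.
apply/is_permP; rewrite size_mkseq; split=> [p pn|p p' pp' pn].
  have ps := raise_range qn pn; rewrite nth_mkseq //.
  have := bs _ ps; have := out _ (raise_out p iq) ps.
  by rewrite /lower; case: (ltnP (nth _ _ _) i); lia.
have ps := raise_range qn pn; have lt_r := raise_lt i (q.+1 - i) pp'.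
rewrite !nth_mkseq //; last by lia.
have v_out := out _ (raise_out p' iq) ps.
have u_out := out _ (raise_out p iq) (ltn_trans lt_r ps).
have uv := injs _ _ lt_r ps.
have := lower_lt iq u_out v_out; have := lower_lt iq v_out u_out.
by lia.
Qed.

(** The property that lets avoidance pass to [block] and [rest], which relabel a subword of [s] in
    an order-preserving way. *)
Definition order_invariant (r : pattern3) : Prop :=
  forall x y z x' y' z', (x < y) = (x' < y') -> (x < z) = (x' < z') ->
    (y < x) = (y' < x') -> (y < z) = (y' < z') ->
    (z < x) = (z' < x') -> (z < y) = (z' < y') -> r x y z = r x' y' z'.

Lemma avl_block r i q s :
    order_invariant r -> avl r s -> q < size s ->
    (forall p, i <= p < q -> i <= nth 0 s p < q) ->
  avl r (block i q s).
Proof.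
move=> inv /avlP h qn hS; apply/avlP => a b c ab bc; rewrite size_mkseq => cn.
rewrite !nth_mkseq; try lia.
have := h (i + a) (i + b) (i + c).
have := hS (i + a); have := hS (i + b); have := hS (i + c) => h1 h2 h3 h4.
rewrite (inv _ _ _ (nth 0 s (i + a)) (nth 0 s (i + b)) (nth 0 s (i + c))).
  by apply: h4; lia.
all: lia.
Qed.

Lemma avl_rest r i q s :
    order_invariant r -> avl r s -> i <= q < size s ->
    (forall p, p < i -> q < nth 0 s p) ->
    (forall p, q < p < size s -> ~~ (i <= nth 0 s p <= q)) ->
  avl r (rest i q s).
Proof.
move=> inv /avlP h qn hN hR; have iq : i <= q by lia.
have out := rest_values iq hN hR.
apply/avlP => a b c ab bc; rewrite size_mkseq => cn.
have b_n := ltn_trans bc cn; have a_n := ltn_trans ab b_n.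
rewrite !nth_mkseq //.
have outs p : p < size s - (q.+1 - i) -> ~~ (i <= nth 0 s (raise i (q.+1 - i) p) <= q).
  by move=> pn; apply: out (raise_out p iq) (raise_range qn pn).
have := h _ _ _ (raise_lt i _ ab) (raise_lt i (q.+1 - i) bc) (raise_range qn cn).
congr (~~ _); apply: inv; symmetry; apply: lower_lt; rewrite ?outs //.
Qed.

(** Pigeonhole: positions i to q already use up all the values i to q. *)
Lemma interval_values i q s :
    is_perm s -> i <= q < size s -> nth 0 s q = q ->
    (forall p, i <= p < q -> i <= nth 0 s p < q) ->
  forall p, q < p < size s -> ~~ (i <= nth 0 s p <= q).
Proof.
move=> sp qn sq hS p pn; have /is_permP[_ inj] := sp.
apply/negP => hp; pose t := [seq nth 0 s j | j <- iota i (q.+1 - i)].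
have ut : uniq t.
  rewrite map_inj_in_uniq ?iota_uniq // => a b; rewrite !mem_iota => ha hb e.
  have := inj a b; have := inj b a; lia.
have sub : {subset t <= iota i (q.+1 - i)}.
  move=> x /mapP[j]; rewrite !mem_iota => hj ->.
  by have := hS j; have [->|] := eqVneq j q; lia.
have [_ e] := uniq_min_size ut sub (eq_leq (esym (size_map _ _))).
have : nth 0 s p \in t by rewrite e mem_iota; lia.
move=> /mapP[j]; rewrite mem_iota => hj ej; apply: (inj j p) => //; lia.
Qed.

(* What makes "inflate at the good index" a bijection onto avoiders with a fixed
   point: the pair (i, rest) can be recovered because i is determined by rest. *)
Record insertion_rule (r : pattern3) (good : nat -> seq nat -> bool) : Prop :=
  InsertionRule {
    rule_invariant : order_invariant r;
    rule_bound : forall i s, good i s -> i <= size s /\ all (leq i) (take i s);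
    rule_exists : forall s, is_perm s -> avl r s -> exists i, good i s;
    rule_unique : forall i j s, is_perm s -> good i s -> good j s -> i = j;
    rule_inflate : forall i A s, is_perm A -> is_perm s -> good i s ->
      avl r A -> avl r s -> avl r (inflate i A s);
    rule_split : forall s q, is_perm s -> avl r s -> q < size s -> nth 0 s q = q ->
      exists i, [/\ i <= q, forall p, p < i -> q < nth 0 s p,
                    forall p, i <= p < q -> i <= nth 0 s p < q &
                    good i (rest i q s)] }.

(** * Counting the avoiders with a fixed point *)

Definition avoiders (r : pattern3) n : seq (seq nat) :=
  [seq s <- permutations (iota 0 n) | avl r s].

Definition deranged_avoiders (r : pattern3) n : seq (seq nat) :=
  [seq s <- avoiders r n | deranged s].

Lemma mem_avoiders r n s :
  (s \in avoiders r n) = [&& size s == n, is_perm s & avl r s].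
Proof.
rewrite mem_filter mem_permutations andbC andbA; congr (_ && _).
apply/idP/andP => [sp|[/eqP <-]//].
by have sn := perm_size sp; rewrite size_iota in sn; rewrite /is_perm sn.
Qed.

Lemma uniq_avoiders r n : uniq (avoiders r n).
Proof. by rewrite filter_uniq // permutations_uniq. Qed.

Lemma nth_inflate_fixed i A s :
  i <= size s -> nth 0 (inflate i A s) (i + size A) = i + size A.
Proof.
move=> im; rewrite nth_mkseq; last by lia.
by rewrite ifF ?ltnn ?eqxx //; lia.
Qed.

Lemma nth_inflate_block i A s p :
  i <= size s -> p < size A -> nth 0 (inflate i A s) (i + p) = i + nth 0 A p.
Proof.
move=> im pA; rewrite nth_mkseq; last by lia.
by rewrite ifF ?ltn_add2l ?pA ?addKn //; lia.
Qed.

Lemma nth_inflate_before i A s p :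
    i <= size s -> all (leq i) (take i s) -> p < i ->
  nth 0 (inflate i A s) p = nth 0 s p + (size A).+1 /\ i <= nth 0 s p.
Proof.
move=> im /(all_nthP 0) hi pi; have := hi p; rewrite size_take_min nth_take //.
rewrite (minn_idPl im) => /(_ pi) hp; split=> //.
by rewrite nth_mkseq ?pi /raise 1?ltnNge ?hp //; lia.
Qed.

(** Entries before i are lifted above the diagonal and the block is deranged, so i + size A is the
    smallest fixed point. *)
Lemma nth_inflate_not_fixed i A s p :
    i <= size s -> all (leq i) (take i s) -> deranged A -> p < i + size A ->
  nth 0 (inflate i A s) p <> p.
Proof.
move=> im hi /derangedP dA pA; have [pi|ip] := ltnP p i.
  by have [-> ] := nth_inflate_before A im hi pi; lia.
have := dA (p - i); rewrite -{3 4}(subnKC ip) nth_inflate_block //; lia.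
Qed.

Lemma inflate_inj i A s j B t :
    i <= size s -> all (leq i) (take i s) -> deranged A -> is_perm A ->
    j <= size t -> all (leq j) (take j t) -> deranged B -> is_perm B ->
  inflate i A s = inflate j B t -> A = B /\ s = t.
Proof.
move=> im hi dA /is_permP[bA _] jm hj dB /is_permP[bB _] e.
(* Both sides are the smallest fixed point of the same word. *)
have eq_fix : i + size A = j + size B.
  case: (ltngtP (i + size A) (j + size B)) => // lt.
    by have := nth_inflate_not_fixed jm hj dB lt; rewrite -e nth_inflate_fixed.
  by have := nth_inflate_not_fixed im hi dA lt; rewrite e nth_inflate_fixed.
(* If i < j, then A is longer than B and position i starts the block A, with an entry below the
   fixed point; read through B, that entry lies above it. *)
have eij : i = j.
  case: (ltngtP i j) => // lt.
    have [] := nth_inflate_before B jm hj lt; rewrite -e => e1 h1.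
    have := @nth_inflate_block i A s 0 im; rewrite addn0 e1.
    by have := bA 0; lia.
  have [] := nth_inflate_before A im hi lt; rewrite e => e1 h1.
  have := @nth_inflate_block j B t 0 jm; rewrite addn0 e1.
  by have := bB 0; lia.
subst j; have {}eq_fix : size A = size B by lia.
have es : size s = size t by have := congr1 size e; rewrite !size_inflate; lia.
split; apply: (@eq_from_nth _ 0) => // p ps.
  have := congr1 (fun u => nth 0 u (i + p)) e.
  by rewrite !nth_inflate_block -?eq_fix //; lia.
have raise_inj w x y : raise i w x = raise i w y -> x = y.
  by rewrite /raise; do !case: ifP; lia.
have [pi|ip] := ltnP p i.
  have := congr1 (fun u => nth 0 u p) e.
  by rewrite !nth_mkseq ?pi -?eq_fix; [exact: raise_inj | lia | lia].
have := congr1 (fun u => nth 0 u (p + (size A).+1)) e.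
rewrite !nth_mkseq -?eq_fix; try lia.
rewrite !ifF; try lia.
by rewrite addnK; exact: raise_inj.
Qed.

Section Recurrence.

Variables (r : pattern3) (good : nat -> seq nat -> bool).
Hypothesis rule : insertion_rule r good.

(** The search list starts at 0, so the index returned by [find] is the insertion place itself. *)
Let good_index s := find (good^~ s) (iota 0 (size s).+1).

Let good_indexP s : is_perm s -> avl r s -> good (good_index s) s.
Proof.
move=> sp av; have [i gi] := rule_exists rule sp av.
have [im _] := rule_bound rule gi.
have has_good : has (good^~ s) (iota 0 (size s).+1).
  by apply/hasP; exists i => //; rewrite mem_iota; lia.
have := nth_find 0 has_good; rewrite nth_iota //.
by have := has_good; rewrite has_find size_iota.
Qed.

Let assemble (p : seq nat * seq nat) := inflate (good_index p.2) p.1 p.2.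

Let pieces n :=
  [seq p | k <- iota 0 n,
           p <- [seq (A, s) | A <- deranged_avoiders r k, s <- avoiders r (n - k.+1)]].

Let mem_pieces n (A s : seq nat) :
  ((A, s) \in pieces n) =
  [&& size A + (size s).+1 == n, is_perm A, avl r A, deranged A, is_perm s & avl r s].
Proof.
apply/allpairsPdep/idP => [[k [p [kn /allpairsP[[B t] /= [hB ht -> [-> ->]]]]]]|].
  move: kn hB ht; rewrite mem_iota mem_filter !mem_avoiders.
  move=> kn /and4P[-> /eqP -> -> ->] /and3P[/eqP -> -> ->]; rewrite !andbT /=; lia.
case/and5P=> sn pA aA dA /andP[ps as_]; exists (size A), (A, s).
split=> //; first by rewrite mem_iota; lia.
apply/allpairsP; exists (A, s); split=> //=.
  by rewrite mem_filter mem_avoiders dA eqxx pA aA.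
by rewrite mem_avoiders ps as_ !andbT -(eqP sn) addnS subSS addKn.
Qed.

(** The index k is recovered as the length of A, so different k contribute disjoint lists. *)
Let uniq_pieces n : uniq (pieces n).
Proof.
apply: allpairs_uniq_dep; first exact: iota_uniq.
  move=> k _; apply: allpairs_uniq; first exact: filter_uniq (uniq_avoiders _ _).
    exact: uniq_avoiders.
  by move=> [? ?] [? ?].
move=> u v; set st := [seq Tagged _ _ | _ <- _, _ <- _].
have tagE w : w \in st -> tag w = size (tagged w).1.
  move=> /allpairsPdep[k [p [_ /allpairsP[[A s] /= [hA _ ->]] ->]]] /=.
  by move: hA; rewrite mem_filter mem_avoiders => /and4P[_ /eqP].
move=> /tagE + /tagE; case: u v => [k p] [l q] /= -> -> e.
by rewrite e.
Qed.

(** [assemble] maps [pieces n] bijectively onto the avoiders with a fixed point: injective by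
    [inflate_inj], surjective by cutting at the smallest fixed point. *)
Lemma count_with_fixed_point n :
  count (predC deranged) (avoiders r n) =
  \sum_(k < n) size (deranged_avoiders r k) * size (avoiders r (n - k.+1)).
Proof.
rewrite -size_filter.
have -> : \sum_(k < n) size (deranged_avoiders r k) * size (avoiders r (n - k.+1))
          = size (map assemble (pieces n)).
  rewrite size_map size_allpairs_dep sumnE big_map.
  rewrite -(big_mkord xpredT (fun k =>
    size (deranged_avoiders r k) * size (avoiders r (n - k.+1)))).
  rewrite /index_iota subn0.
  by apply: eq_bigr => k _; rewrite size_allpairs.
apply/perm_size/uniq_perm.
- by rewrite filter_uniq // uniq_avoiders.
- rewrite map_inj_in_uniq // => -[A s] [B t]; rewrite !mem_pieces.
  case/and5P=> _ pA aA dA /andP[ps as_] /and5P[_ pB aB dB /andP[pt at_]].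
  have [im hi] := rule_bound rule (good_indexP ps as_).
  have [jm hj] := rule_bound rule (good_indexP pt at_).
  by move=> /(inflate_inj im hi dA pA jm hj dB pB) [-> ->].
move=> w; move: (w : seq nat) => {}w; rewrite mem_filter mem_avoiders; apply/idP/mapP => [|[[A s]]].
  case/and4P=> /= /derangedP fixed /eqP wn pw aw.
  (* Taking the smallest fixed point is what makes the block deranged. *)
  have [q /andP[qw /eqP wq] first] : exists2 q, (q < size w) && (nth 0 w q == q) &
      forall p, p < q -> nth 0 w p <> p.
    have ex_q : exists q, (q < size w) && (nth 0 w q == q).
      case: (pickP (fun q : 'I_(size w) => nth 0 w q == q :> nat)) => [q h|none].
        by exists q; rewrite ltn_ord.
      by case: fixed => q qw /eqP; rewrite (none (Ordinal qw)).
    case: (ex_minnP ex_q) => q hq min_q; exists q => // p pq /eqP e.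
    by have := min_q p; rewrite e andbT; lia.
  have [i [iq hN hS gi]] := rule_split rule pw aw qw wq.
  have hiq : i <= q < size w by rewrite iq.
  have hR := interval_values pw hiq wq hS.
  have inv := rule_invariant rule.
  have pr := rest_perm pw hiq hN hR.
  have ar := avl_rest inv aw hiq hN hR.
  exists (block i q w, rest i q w); last first.
    (* Uniqueness identifies the place found by [good_index] in the rest with the place i of the
       cut. *)
    rewrite /assemble /= (rule_unique rule pr (good_indexP pr ar) gi).
    by rewrite inflate_block_rest.
  rewrite mem_pieces pr ar (block_perm pw qw hS) (avl_block inv aw qw hS).
  rewrite !size_mkseq andbT -wn; apply/andP; split; first by lia.
  rewrite /= andbT.
  apply/derangedP => p; rewrite size_mkseq => pn; rewrite nth_mkseq //.
  by have := first (i + p); have := hS (i + p); lia.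
rewrite mem_pieces => /and5P[sn pA aA dA /andP[ps as_]] ->.
have gs := good_indexP ps as_; have [im hi] := rule_bound rule gs.
rewrite /assemble /= size_inflate inflate_perm // (rule_inflate rule) //.
rewrite !andbT; apply/andP; split; last by lia.
apply/derangedP => h; apply: (h (good_index s + size A)).
  by rewrite size_inflate addnS ltnS leq_add2r.
exact: nth_inflate_fixed.
Qed.

Lemma avoiders_recurrence n :
  size (avoiders r n) = size (deranged_avoiders r n) +
    \sum_(k < n) size (deranged_avoiders r k) * size (avoiders r (n - k.+1)).
Proof. by rewrite -count_with_fixed_point [size (deranged_avoiders _ _)]size_filter count_predC. Qed.

End Recurrence.

(** Strong induction: the sums in the two recurrences involve only smaller k, so they agree and
    cancel. *)
Lemma deranged_avoiders_eq r r' good good' :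
    insertion_rule r good -> insertion_rule r' good' ->
    (forall n, size (avoiders r n) = size (avoiders r' n)) ->
  forall n, size (deranged_avoiders r n) = size (deranged_avoiders r' n).
Proof.
move=> rule rule' eq_av; elim/ltn_ind => n IH.
have := eq_av n; rewrite (avoiders_recurrence rule) (avoiders_recurrence rule').
by rewrite (eq_bigr _ (fun (k : 'I_n) _ =>
  congr2 muln (IH k (ltn_ord k)) (eq_av (n - k.+1)))) => /addIn.
Qed.

(** * Insertion places for 132 and 321 *)

Lemma pairwise_dropP (r : rel nat) i s :
  reflect (forall j k, i <= j -> j < k -> k < size s -> r (nth 0 s j) (nth 0 s k))
          (pairwise r (drop i s)).
Proof.
apply: (iffP (pairwiseP 0)) => [h j k ij jk ks|h j k].
  have ik : i <= k by lia.
  have := h (j - i) (k - i); rewrite !inE size_drop !nth_drop !subnKC //.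
  by apply; lia.
by rewrite !inE size_drop !nth_drop => ? ? ?; apply: h; lia.
Qed.

Lemma takeP i s : i <= size s ->
  reflect (forall p, p < i -> i <= nth 0 s p) (all (leq i) (take i s)).
Proof.
move=> im; apply: (iffP (all_nthP 0)); rewrite size_take_min (minn_idPl im).
  by move=> h p pi; have := h p pi; rewrite nth_take.
by move=> h p pi; rewrite nth_take // h.
Qed.

(** The first i entries are at least i, and from position i on the values that are at least i
    increase. *)
Definition good132 (i : nat) (s : seq nat) : bool :=
  [&& i <= size s, all (leq i) (take i s) &
      pairwise (fun y z => ~~ (i <= z < y)) (drop i s)].

Definition good321 (i : nat) (s : seq nat) : bool := i == 0.

(** Take the largest i whose first i entries are all at least i. Maximality gives an entry at most i
    at a position at most i, and a later descent among values at least i would complete it to a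
    132. *)
Lemma good132_exists s : is_perm s -> avl p132 s -> exists i, good132 i s.
Proof.
move=> /is_permP[bs injs] /avlP av.
pose P i := (i <= size s) && all (leq i) (take i s).
have exP : exists i, P i by exists 0; rewrite /P take0.
have ubP i : P i -> i <= size s by case/andP.
have [i /andP[im hi] maxi] := ex_maxnP exP ubP.
exists i; rewrite /good132 im hi /=; apply/pairwise_dropP => j k ij jk ks.
apply/negP => /andP[ik kj].
have [l li hl] : exists2 l, l <= i & nth 0 s l <= i.
  have : ~~ all (leq i.+1) (take i.+1 s).
    by apply/negP => h; have := maxi i.+1; rewrite /P h; lia.
  rewrite -has_predC => /(has_nthP 0)[l]; rewrite size_take_min /= => hl.
  by rewrite nth_take -?leqNgt; [exists l; lia | lia].
have lj : l <> j by move=> e; subst l; lia.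
have := av l j k; have := injs l k; rewrite /p132; lia.
Qed.

Lemma good132_unique i j s : is_perm s -> good132 i s -> good132 j s -> i = j.
Proof.
move=> ps; wlog lt : i j / i < j => [hw gi gj|].
  by case: (ltngtP i j) => // lt; [exact: hw | symmetry; exact: hw].
case/and3P=> _ _ /pairwise_dropP hi /and3P[jm /(takeP jm) hj _].
have im : i < size s by lia.
(* For i < j, goodness of j puts an entry above i at position i and the value i itself at some k >=
   j: a descent forbidden by goodness of i. *)
have [k ks ki] := perm_surj ps im.
have := hj i lt; have := hj k; have := hi i k; rewrite ki; lia.
Qed.

Lemma is_perm_rcons_lt A p : is_perm A -> p <= size A ->
  nth 0 (rcons A (size A)) p <= size A.
Proof.
by move=> /is_perm_rcons /is_permP[]; rewrite size_rcons => h _; exact: h.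
Qed.

(** An appended maximum could only play the last entry of the pattern, which is not its largest. *)
Lemma avl_rcons_max (r : pattern3) A :
    (forall x y z, r x y z -> z < y \/ z < x) -> is_perm A ->
  avl r A -> avl r (rcons A (size A)).
Proof.
move=> hr /is_permP[bA _] /avlP av; apply/avlP => a b c ab bc.
rewrite size_rcons !nth_rcons => cn.
rewrite (_ : a < size A) 1?(_ : b < size A); try lia.
have [cA|Ac] := ltnP c (size A); first exact: av.
rewrite (_ : c == size A); last by lia.
by apply/negP => /hr; have := bA a; have := bA b; lia.
Qed.

Lemma avl_inflate132 i A s :
    is_perm A -> is_perm s -> good132 i s -> avl p132 A -> avl p132 s ->
  avl p132 (inflate i A s).
Proof.
move=> pA ps /and3P[im hi /pairwise_dropP gi] avA /avlP avs.
have /avlP avA' : avl p132 (rcons A (size A)).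
  by apply: avl_rcons_max => // x y z; rewrite /p132; lia.
have bA p : p <= size A -> nth 0 (rcons A (size A)) p <= size A.
  exact: is_perm_rcons_lt.
rewrite size_rcons in avA'.
apply/avlP => a b c ab bc cn; rewrite /p132.
have rP v := raiseP i (size A).+1 v.
have bn := ltn_trans bc cn; have an := ltn_trans ab bn.
have [[ci hc ->]|[ci ->]|[ci hc ->]] := inflateP im hi cn;
have [[bi hb ->]|[bi ->]|[bi hb ->]] := inflateP im hi bn;
have [[ai ha ->]|[ai ->]|[ai ha ->]] := inflateP im hi an; try lia.
- by have := avs a b c; rewrite /p132; lia.
- by have := bA (c - i); lia.
- by have := bA (b - i); lia.
- by have := avA' (a - i) (b - i) (c - i); rewrite /p132; lia.
- by have := avs a b (c - (size A).+1); have := rP (nth 0 s (c - (size A).+1));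
    rewrite /p132; lia.
- by have := bA (b - i); lia.
- by have := bA (b - i); have := rP (nth 0 s (c - (size A).+1)); lia.
- by have := avs a (b - (size A).+1) (c - (size A).+1);
    have := rP (nth 0 s (b - (size A).+1)); have := rP (nth 0 s (c - (size A).+1));
    rewrite /p132; lia.
(* The smallest entry lies in the block and the other two after it: here the monotonicity in
   [good132] is needed. *)
- by have := gi (b - (size A).+1) (c - (size A).+1);
    have := rP (nth 0 s (b - (size A).+1)); have := rP (nth 0 s (c - (size A).+1)); lia.
- have := avs (a - (size A).+1) (b - (size A).+1) (c - (size A).+1); rewrite /p132.
  have [[? ->]|[? ->]] := rP (nth 0 s (a - (size A).+1));
  have [[? ->]|[? ->]] := rP (nth 0 s (b - (size A).+1));
  have [[? ->]|[? ->]] := rP (nth 0 s (c - (size A).+1)); lia.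
Qed.

(** Inflating at 0 is a direct sum, and no occurrence of 321 straddles its two summands. *)
Lemma avl_inflate321 A s :
    is_perm A -> is_perm s -> avl p321 A -> avl p321 s ->
  avl p321 (inflate 0 A s).
Proof.
move=> pA ps avA /avlP avs.
have /avlP avA' : avl p321 (rcons A (size A)).
  by apply: avl_rcons_max => // x y z; rewrite /p321; lia.
have bA p : p <= size A -> nth 0 (rcons A (size A)) p <= size A.
  exact: is_perm_rcons_lt.
rewrite size_rcons in avA'.
apply/avlP => a b c ab bc cn; rewrite /p321.
have bn := ltn_trans bc cn; have an := ltn_trans ab bn.
have im : 0 <= size s by []; have hi : all (leq 0) (take 0 s) by rewrite take0.
have [[ci hc ->]|[ci ->]|[ci hc ->]] := inflateP im hi cn;
have [[bi hb ->]|[bi ->]|[bi hb ->]] := inflateP im hi bn;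
have [[ai ha ->]|[ai ->]|[ai ha ->]] := inflateP im hi an; rewrite ?subn0 ?add0n /raise ?ltn0 /=; try lia.
- by have := avA' a b c; rewrite /p321; lia.
- by have := bA b; lia.
- by have := bA a; lia.
- have := avs (a - (size A).+1) (b - (size A).+1) (c - (size A).+1); rewrite /p321; lia.
Qed.

Lemma split132 s q :
    is_perm s -> avl p132 s -> q < size s -> nth 0 s q = q ->
  exists i, [/\ i <= q, forall p, p < i -> q < nth 0 s p,
                forall p, i <= p < q -> i <= nth 0 s p < q &
                good132 i (rest i q s)].
Proof.
move=> ps /avlP av qs sq; have /is_permP[bs injs] := ps; rewrite /p132 in av.
(* The cut i is the first position with an entry below q, or q itself if there is none before it. *)
have ex_i : exists i, (i == q) || (nth 0 s i < q) by exists q; rewrite eqxx.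
have [i iP min_i] := ex_minnP ex_i.
have iq : i <= q by apply: min_i; rewrite eqxx.
have hN p : p < i -> q < nth 0 s p.
  by move=> pi; have := min_i p; have := injs p q; rewrite sq; lia.
(* An entry above q between i and q would form a 132 with the entries at i and q. *)
have below p : i <= p < q -> nth 0 s p < q.
  move=> hp; have := injs p q; have := injs i p; have := av i p q; rewrite sq.
  by have [e|ne] := eqVneq p i; [subst p|]; lia.
have hS p : i <= p < q -> i <= nth 0 s p < q.
  move=> hp; have lt_q := below p hp; rewrite lt_q andbT.
  (* Every value in [s_p, q) sits at a position in [i, q). *)
  have sub : {subset iota (nth 0 s p) (q - nth 0 s p) <=
              [seq nth 0 s j | j <- iota i (q - i)]}.
    move=> v; rewrite mem_iota => hv.
    have vs : v < size s by lia.
    have [j js jv] := perm_surj ps vs.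
    apply/mapP; exists j => //; rewrite mem_iota.
    have ji : i <= j by have := hN j; lia.
    have := av p q j; have := injs p j; rewrite sq jv.
    by have [e|] := eqVneq j q; [subst j|]; lia.
  by have := uniq_leq_size (iota_uniq _ _) sub; rewrite size_map !size_iota; lia.
exists i; split=> //.
have isz : i <= size (rest i q s) by rewrite size_mkseq; lia.
have hiq : i <= q < size s by rewrite iq.
have hR := interval_values ps hiq sq hS.
rewrite /good132 isz /=; apply/andP; split.
  apply/(takeP isz) => p pi; rewrite nth_mkseq; last by move: isz; rewrite size_mkseq; lia.
  by rewrite /raise pi /lower ifF; have := hN p pi; lia.
apply/pairwise_dropP => j k ij jk; rewrite size_mkseq => kn.
rewrite !nth_mkseq //; last by lia.
have -> : raise i (q.+1 - i) j = j + (q.+1 - i) by rewrite /raise ifF; lia.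
have -> : raise i (q.+1 - i) k = k + (q.+1 - i) by rewrite /raise ifF; lia.
have := hR (j + (q.+1 - i)); have := hR (k + (q.+1 - i)).
(* The fixed point q would be the smallest entry of a 132 completed by a descent among larger later
   values. *)
have := av q (j + (q.+1 - i)) (k + (q.+1 - i)); rewrite sq /lower.
by case: (ltnP (nth 0 s (j + (q.+1 - i))) i) => ?;
  case: (ltnP (nth 0 s (k + (q.+1 - i))) i) => ?; lia.
Qed.

Lemma split321 s q :
    is_perm s -> avl p321 s -> q < size s -> nth 0 s q = q ->
  exists i, [/\ i <= q, forall p, p < i -> q < nth 0 s p,
                forall p, i <= p < q -> i <= nth 0 s p < q &
                good321 i (rest i q s)].
Proof.
move=> ps /avlP av qs sq; have /is_permP[bs injs] := ps; rewrite /p321 in av.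
exists 0; split=> // p pq; rewrite leq0n /= ltnNge; apply/negP => qp.
have ne : nth 0 s p <> q by rewrite -sq; apply: injs; lia.
(* With an entry above q before position q, a smaller value after q would complete a 321; so all q
   values below q fill the first q positions, leaving no room for that entry. *)
have sub : {subset iota 0 q <= [seq nth 0 s j | j <- iota 0 q]}.
  move=> v; rewrite mem_iota => hv.
  have vs : v < size s by lia.
  have [j js jv] := perm_surj ps vs.
  apply/mapP; exists j => //; rewrite mem_iota.
  have := av p q j; rewrite sq jv.
  by have [e|] := eqVneq j q; [subst j|]; lia.
have [_ e] := uniq_min_size (iota_uniq _ _) sub (eq_leq (size_map _ _)).
have : nth 0 s p \in iota 0 q by rewrite e; apply: map_f; rewrite mem_iota; lia.
by rewrite mem_iota; lia.
Qed.

Lemma insertion_rule132 : insertion_rule p132 good132.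
Proof.
split.
- by move=> x y z x' y' z'; rewrite /p132; lia.
- by move=> i s /and3P[].
- exact: good132_exists.
- exact: good132_unique.
- exact: avl_inflate132.
- exact: split132.
Qed.

Lemma insertion_rule321 : insertion_rule p321 good321.
Proof.
split.
- by move=> x y z x' y' z'; rewrite /p321; lia.
- by move=> i s /eqP->; rewrite take0.
- by move=> s _ _; exists 0.
- by move=> i j s _ /eqP-> /eqP->.
- by move=> i A s pA ps /eqP-> ; exact: avl_inflate321.
- exact: split321.
Qed.

(** * Back to permutations: 132 and 321 *)

Lemma card_avoidersE r n : card_avoiders r n = size (avoiders r n).
Proof.
rewrite size_filter -card_one_line; apply: eq_card => pi.
by rewrite !inE avl_one_line.
Qed.

Lemma card_derangementsE r n : card_derangements r n = size (deranged_avoiders r n).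
Proof.
rewrite /deranged_avoiders /avoiders -filter_predI size_filter -card_one_line.
by apply: eq_card => pi; rewrite !inE /= avl_one_line deranged_one_line andbC.
Qed.

Lemma card_derangements_132_321 n :
  card_derangements p132 n = card_derangements p321 n.
Proof.
rewrite !card_derangementsE.
apply: deranged_avoiders_eq insertion_rule132 insertion_rule321 _ n => m.
by rewrite -!card_avoidersE -card_avoiders_123_132 card_avoiders_123_321.
Qed.

(** * The classes *)

(** Index of the class, with words shifted to start at 0: 123 alone, then 231 and 312, then 132, 213
    and 321. *)
Definition kind (alpha : 'S_3) : nat :=
  if one_line alpha == [:: 0; 1; 2] then 0
  else if one_line alpha \in [:: [:: 1; 2; 0]; [:: 2; 0; 1]] then 1 else 2.

Definition kind_pattern (k : nat) : pattern3 :=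
  if k is k'.+1 then if k' is 0 then p231 else p132 else p123.

Lemma d_pattern (p : pattern3) (alpha : 'S_3) n :
    (forall x y z, order_isomorphic [:: x; y; z] (one_line alpha) = p x y z) ->
  d n alpha = card_derangements p n.
Proof.
move=> e; apply: eq_card => pi; rewrite !inE; congr (~~ _ && _).
exact: (eq_occurs pi e).
Qed.

Lemma one_line3 (alpha : 'S_3) :
  one_line alpha \in [:: [:: 0; 1; 2]; [:: 0; 2; 1]; [:: 1; 0; 2];
                        [:: 1; 2; 0]; [:: 2; 0; 1]; [:: 2; 1; 0]].
Proof.
set words := [:: [:: 0; 1; 2] ; _; _; _; _; _].
have sub : all (mem words) (permutations (iota 0 3)) by vm_compute.
by apply: (allP sub); rewrite mem_permutations perm_one_line.
Qed.

Lemma d_kind (alpha : 'S_3) n :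
  d n alpha = card_derangements (kind_pattern (kind alpha)) n.
Proof.
rewrite /kind; have := one_line3 alpha; rewrite !inE.
case/or4P=> [/eqP e|/eqP e|/eqP e|/or3P[]/eqP e]; rewrite e /=.
- by apply: d_pattern => x y z; rewrite e order_isomorphic3 /p123; lia.
- by apply: d_pattern => x y z; rewrite e order_isomorphic3 /p132; lia.
- rewrite card_derangements_132_213.
  by apply: d_pattern => x y z; rewrite e order_isomorphic3 /p213; lia.
- by apply: d_pattern => x y z; rewrite e order_isomorphic3 /p231; lia.
- rewrite card_derangements_231_312.
  by apply: d_pattern => x y z; rewrite e order_isomorphic3 /p312; lia.
- rewrite card_derangements_132_321.
  by apply: d_pattern => x y z; rewrite e order_isomorphic3 /p321; lia.
Qed.

Lemma kind_lt (alpha : 'S_3) : kind alpha < 3.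
Proof. by rewrite /kind; do !case: ifP. Qed.

(** Size 3 separates 231 from the other two representatives, and size 4 separates 123 from 132. *)
Lemma small_cards :
  [/\ card_derangements p123 3 = 2, card_derangements p132 3 = 2,
      card_derangements p231 3 = 1, card_derangements p123 4 = 7 &
      card_derangements p132 4 = 6].
Proof. by rewrite !card_derangementsE; split; vm_compute. Qed.

Lemma D_Wilf_kind (alpha beta : 'S_3) : D_Wilf alpha beta <-> kind alpha = kind beta.
Proof.
split=> [h|e n _]; last by rewrite !d_kind e.
have := h 3 isT; have := h 4 isT; rewrite !d_kind.
have [e1 e2 e3 e4 e5] := small_cards.
move: (kind_lt alpha) (kind_lt beta).
by case: (kind alpha) => [|[|[|]]] //; case: (kind beta) => [|[|[|]]] //= _ _;
  rewrite ?e1 ?e2 ?e3 ?e4 ?e5.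
Qed.

Lemma kind_surj k : k < 3 -> exists alpha, kind alpha = k.
Proof.
have wit w : perm_eq w (iota 0 3) -> exists alpha : 'S_3, one_line alpha = w.
  exact: one_line_surj.
case: k => [|[|[|//]]] _.
- by have [alpha e] := wit [:: 0; 1; 2] isT; exists alpha; rewrite /kind e.
- by have [alpha e] := wit [:: 1; 2; 0] isT; exists alpha; rewrite /kind e.
- by have [alpha e] := wit [:: 0; 2; 1] isT; exists alpha; rewrite /kind e.
Qed.

Theorem theorem6p2 : #|D_Wilf_classes| = 3.
Proof.
(* The classes are the fibres of [kind], which takes exactly three values. *)
pose cls (alpha : 'S_3) := [set beta in [set: 'S_3] | kind alpha == kind beta].
have clsE (alpha beta : 'S_3) : (cls alpha == cls beta) = (kind alpha == kind beta).
  apply/eqP/eqP => [/setP/(_ beta)|e]; last by apply/setP => c; rewrite !inE e.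
  by rewrite !inE eqxx => /eqP.
have -> : D_Wilf_classes = cls @: [set: 'S_3].
  apply: eq_imset => alpha; apply/setP => beta; rewrite !inE.
  by apply/boolp.asboolP/eqP => /D_Wilf_kind.
have [a0 k0] := kind_surj (isT : 0 < 3).
have [a1 k1] := kind_surj (isT : 1 < 3).
have [a2 k2] := kind_surj (isT : 2 < 3).
have -> : cls @: [set: 'S_3] = [set cls a0; cls a1; cls a2].
  apply/setP => K; rewrite !inE; apply/imsetP/idP => [[alpha _ ->]|].
    rewrite !clsE k0 k1 k2; have := kind_lt alpha.
    by case: (kind alpha) => [|[|[|]]].
  by case/orP=> [/orP[]|] /eqP->; [exists a0 | exists a1 | exists a2].
by rewrite -setUA !cardsU1 cards1 !inE !clsE k0 k1 k2.
Qed.
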